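(* Given any path $Q$, any event $b\notin Q$, and distinct events $Q_x,Q_z\in Q(b,\emptyset)$, for every event $Q_y$, $$[Q_x\;Q_y\;Q_z]\implies Q_y\in Q(b,\emptyset).$$
   Context: Let $\mathcal E$ be a set, whose elements are called events; let $\mathcal P$ be a set of subsets of $\mathcal E$, whose elements are called paths; and let $[\,\cdot\;\cdot\;\cdot\,]$ be a ternary relation (betweenness) on $\mathcal E$. Definitions. A finite chain is a sequence $(q_0,\dots,q_n)$ of events, $n\ge1$, such that: if $n=1$, then $q_0\ne q_1$ and some path contains both; if $n\ge2$, then $[q_i\;q_j\;q_k]$ for all $0\le i<j<k\le n$. An infinite chain is a sequence $(q_i)_{i\in\mathbb N}$ of events with $[q_i\;q_j\;q_k]$ for all $i<j<k$. A bound of an infinite chain is an event $q$ with $[q_i\;q_j\;q]$ for all $i<j$; a closest bound is a bound $q$ such that $[q_0\;q\;q']$ for every bound $q'\ne q$. For a path $Q$ and an event $b\notin Q$, the unreachable subset of $Q$ from $b$ is $Q(b,\emptyset)=\{x\in Q:\text{ no path contains both } b \text{ and } x\}$. For distinct paths $Q,R$ meeting at $x$ and $Q_a\in Q$, $Q(Q_a,R,x,\emptyset)=\{y: [x\;y\;Q_a]\text{ and there is } w\in R \text{ (}w\notin Q\text{) with } Q_a,y\in Q(w,\emptyset)\}$. $\mathrm{SPRAY}[x]$ is the set of paths containing the event $x$. Three distinct paths of $\mathrm{SPRAY}[x]$ are dependent if some path not in $\mathrm{SPRAY}[x]$ meets each of the three; then each is said to be dependent on the set of the other two. Inductively, a path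 $T$ is dependent on a set $S\subseteq\mathrm{SPRAY}[x]$ with $n\ge3$ elements if $T$ is dependent on a set of two paths $\{S_1,S_2\}$, each of which is dependent on some subset of $S$ with $n-1$ elements. A set of paths is dependent if it contains a path $P$ and a subset not containing $P$ on which $P$ is dependent (for some $x$); it is independent if it has no dependent subset. $\mathrm{SPRAY}[x]$ is a 3-SPRAY if it contains four distinct paths forming an independent set such that every path of $\mathrm{SPRAY}[x]$ is dependent on the set of these four. The following axioms are assumed. (I1) $\mathcal E\neq\emptyset$. (I2) For distinct events $a,b$ there are paths $R\ni a$, $S\ni b$ with $R\cap S\ne\emptyset$. (I3) For any two distinct events there is at most one path containing both. (I4) If $\mathcal E\ne\emptyset$, there is at least one 3-SPRAY. (O1) If $[a\;b\;c]$ then some path contains $a,b,c$. (O2) $[a\;b\;c]\Rightarrow[c\;b\;a]$. (O3) $[a\;b\;c]\Rightarrow a\neq c$. (O4) $[a\;b\;c]$ and $[b\;c\;d]$ imply $[a\;b\;d]$ (no distinctness of $a,d$ is assumed). (O5) If $a,b,c$ are distinct events of one path, then $[a\;b\;c]$ or $[b\;c\;a]$ or $[c\;a\;b]$. (O6) If $Q,R,S$ are distinct paths, $T$ is a path, $a\in Q\cap R$, $b\in Q\cap S$, $c\in R\cap S$, and there are $d\in S$ with $[b\;c\;d]$ and $e\in R$ with $[c\;e\;a]$ and $d,e\in T$, then there is $f\in T\cap Q$ belonging to a finite chain with first event $a$ and last event $b$, where $a,f,b$ are distinct. (I5) For any path $Q$ and event $b\notin Q$, the set $Q(b,\emptyset)$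 contains at least two events. (I6) For any path $Q$, event $b\notin Q$ and distinct $Q_x,Q_z\in Q(b,\emptyset)$ there is a finite chain $(q_0,\dots,q_n)$ with $q_0=Q_x$, $q_n=Q_z$ such that for all $i\in\{1,\dots,n\}$: $q_i\in Q(b,\emptyset)$, and every event $y$ with $[q_{i-1}\;y\;q_i]$ lies in $Q(b,\emptyset)$. (I7) For any path $Q$, event $b\notin Q$, $Q_x\in Q\setminus Q(b,\emptyset)$ and $Q_y\in Q(b,\emptyset)$ there is a finite chain $(q_0,\dots,q_n)$ and $0<m<n$ with $q_0=Q_x$, $q_m=Q_y$ and $q_n\in Q\setminus Q(b,\emptyset)$. (S) If $Q,R,S$ are distinct paths with $x\in Q\cap R\cap S$, and $Q_a\in Q\setminus\{x\}$ satisfies $Q(Q_a,R,x,\emptyset)=Q(Q_a,S,x,\emptyset)$, then there is a map $\theta:\mathcal E\to\mathcal E$ such that $P\mapsto\theta(P)$ (direct image) is a bijection $\mathcal P\to\mathcal P$, $\theta(y)=y$ for all $y\in Q$, and $\theta(R)=S$. (C) Every infinite chain that has a bound has a closest bound. *)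

(* Defs.v *)
From mathcomp Require Import all_boot.
From mathcomp Require Import boolp classical_sets functions cardinality.

Set Implicit Arguments.
Unset Strict Implicit.
Unset Printing Implicit Defensive.

Local Open Scope classical_set_scope.
Local Open Scope card_scope.

(** Throughout, [E] is the type of events, [P : set (set E)] the set of paths,
    and [btw a b c] the betweenness relation [a b c]. *)

Definition joined (E : Type) (P : set (set E)) (a b : E) : Prop :=
  exists R, [/\ P R, R a & R b].

(** A finite chain (q_0, ..., q_n) is given by [q : nat -> E] together with its
    last index [n]; the values of [q] beyond [n] are irrelevant. *)
Definition finite_chain (E : Type) (P : set (set E)) (btw : E -> E -> E -> Prop)
    (q : nat -> E) (n : nat) : Prop :=
  [/\ 1 <= n,
      n = 1 -> q 0 <> q 1 /\ joined P (q 0) (q 1)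
    & 2 <= n -> forall i j k, i < j -> j < k -> k <= n ->
        btw (q i) (q j) (q k)].

Definition infinite_chain (E : Type) (btw : E -> E -> E -> Prop)
    (q : nat -> E) : Prop :=
  forall i j k, i < j -> j < k -> btw (q i) (q j) (q k).

Definition chain_bound (E : Type) (btw : E -> E -> E -> Prop)
    (q : nat -> E) (c : E) : Prop :=
  forall i j, i < j -> btw (q i) (q j) c.

Definition closest_bound (E : Type) (btw : E -> E -> E -> Prop)
    (q : nat -> E) (c : E) : Prop :=
  chain_bound btw q c /\
  forall c', chain_bound btw q c' -> c' <> c -> btw (q 0) c c'.

(** Q(b, ∅); only meaningful when [Q] is a path and [b] is not on [Q]. *)
Definition unreach (E : Type) (P : set (set E)) (Q : set E) (b : E) : set E :=
  [set x | Q x /\ ~ joined P b x].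

(** Q(Q_a, R, x, ∅), for distinct paths [Q], [R] meeting at [x] and [a] on [Q]. *)
Definition unreach_via (E : Type) (P : set (set E)) (btw : E -> E -> E -> Prop)
    (Q : set E) (a : E) (R : set E) (x : E) : set E :=
  [set y | btw x y a /\
     exists w, [/\ R w, ~ Q w, unreach P Q w a & unreach P Q w y]].

Definition SPRAY (E : Type) (P : set (set E)) (x : E) : set (set E) :=
  [set Q | P Q /\ Q x].

Definition dependent3 (E : Type) (P : set (set E)) (x : E)
    (Q R S : set E) : Prop :=
  [/\ SPRAY P x Q, SPRAY P x R & SPRAY P x S] /\
  [/\ Q <> R, R <> S & Q <> S] /\
  exists W, [/\ P W, ~ SPRAY P x W,
    W `&` Q !=set0, W `&` R !=set0 & W `&` S !=set0].

(** [depends_on P x T S]: the path [T] is dependent on the set of paths [S].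
    In [depends_on_step] the set [S] has [n.+1 >= 3] elements. As the second
    constructor never concludes about a two-element set, [depends_on P x T [set S1; S2]]
    always comes from a triple of distinct dependent paths. *)
Inductive depends_on (E : Type) (P : set (set E)) (x : E) :
    set E -> set (set E) -> Prop :=
| depends_on_pair T R S :
    dependent3 P x T R S -> depends_on P x T [set R; S]
| depends_on_step n T S S1 S2 U1 U2 :
    2 <= n -> S `<=` SPRAY P x -> S #= `I_n.+1 ->
    depends_on P x T [set S1; S2] ->
    U1 `<=` S -> U1 #= `I_n -> depends_on P x S1 U1 ->
    U2 `<=` S -> U2 #= `I_n -> depends_on P x S2 U2 ->
    depends_on P x T S.

Definition dependent_set (E : Type) (P : set (set E)) (S : set (set E)) : Prop :=
  exists x T U, [/\ S T, U `<=` S, ~ U T & depends_on P x T U].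

Definition independent_set (E : Type) (P : set (set E)) (S : set (set E)) : Prop :=
  forall U, U `<=` S -> ~ dependent_set P U.

Definition is_3SPRAY (E : Type) (P : set (set E)) (x : E) : Prop :=
  exists F : set (set E), [/\ F `<=` SPRAY P x, F #= `I_4, independent_set P F
    & forall T, SPRAY P x T -> depends_on P x T F].

Record spacetime_axioms (E : Type) (P : set (set E))
    (btw : E -> E -> E -> Prop) : Prop := SpacetimeAxioms {
  axI1 : [set: E] !=set0;
  axI2 : forall a b, a <> b ->
    exists R S, [/\ P R, P S, R a, S b & R `&` S !=set0];
  axI3 : forall a b, a <> b -> forall R S, P R -> P S ->
    R a -> R b -> S a -> S b -> R = S;
  axI4 : [set: E] !=set0 -> exists x, is_3SPRAY P x;
  axO1 : forall a b c, btw a b c -> exists R, [/\ P R, R a, R b & R c];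
  axO2 : forall a b c, btw a b c -> btw c b a;
  axO3 : forall a b c, btw a b c -> a <> c;
  axO4 : forall a b c d, btw a b c -> btw b c d -> btw a b d;
  axO5 : forall R a b c, P R -> R a -> R b -> R c ->
    a <> b -> b <> c -> a <> c -> [\/ btw a b c, btw b c a | btw c a b];
  axO6 : forall Q R S T a b c d e,
    P Q -> P R -> P S -> P T -> Q <> R -> R <> S -> Q <> S ->
    (Q `&` R) a -> (Q `&` S) b -> (R `&` S) c ->
    S d -> btw b c d -> R e -> btw c e a -> T d -> T e ->
    exists f q n, [/\ (T `&` Q) f, finite_chain P btw q n,
      q 0 = a /\ q n = b, exists2 i, i <= n & q i = f
      & [/\ a <> f, f <> b & a <> b]];
  axI5 : forall Q b, P Q -> ~ Q b ->
    exists x y, [/\ x <> y, unreach P Q b x & unreach P Q b y];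
  axI6 : forall Q b x z, P Q -> ~ Q b ->
    unreach P Q b x -> unreach P Q b z -> x <> z ->
    exists q n, [/\ finite_chain P btw q n, q 0 = x, q n = z
      & forall i, 1 <= i <= n -> unreach P Q b (q i) /\
          forall y, btw (q i.-1) y (q i) -> unreach P Q b y];
  axI7 : forall Q b x y, P Q -> ~ Q b ->
    (Q `\` unreach P Q b) x -> unreach P Q b y ->
    exists q n m, [/\ finite_chain P btw q n, 0 < m < n,
      q 0 = x, q m = y & (Q `\` unreach P Q b) (q n)];
  axS : forall Q R S x a, P Q -> P R -> P S ->
    Q <> R -> R <> S -> Q <> S -> Q x -> R x -> S x -> Q a -> a <> x ->
    unreach_via P btw Q a R x = unreach_via P btw Q a S x ->
    exists theta : E -> E,
      [/\ set_bij P P (fun W => theta @` W),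
          forall y, Q y -> theta y = y & theta @` R = S];
  axC : forall q, infinite_chain btw q -> (exists c, chain_bound btw q c) ->
    exists c, closest_bound btw q c
}.

(* Main.v *)
Require Import Defs.
From mathcomp Require Import all_boot.
From mathcomp Require Import boolp classical_sets functions cardinality.

(** The chain given by (I6) covers the segment from [Qx] to [Qz], provided that
    [a m c] and [a y c] with [y <> m] imply [a y m] or [m y c]. The axioms (O2)-(O5)
    alone reduce this to excluding four collinear events with [a o b], [b o c]
    and [a b c]. To exclude them, take an event [e] off the path that is joined to
    [o] and [b], and prolong [o e] to [o e w]. Moving [a] and [c] away from [o]
    preserves the three relations, so by (I7) they may be taken to be joined to [w].
    By (O6) the path [e b] crosses the sides [w a] and [w c] of the triangle
    [w a c], and it also meets the side [a c] in [b]; but a path cannot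
    cross all three sides of a triangle. *)

Section Spacetime.
Context {E : Type} {P : set (set E)} {btw : E -> E -> E -> Prop}.
Hypothesis ax : spacetime_axioms P btw.

(** * Consequences of the order and incidence axioms *)

Lemma btw_neq12 {a b c} : btw a b c -> a <> b.
Proof.
move=> h eab; move: h; rewrite -eab => h.
(* (O4) applied to [c a a] and [a a c] yields [c a c], against (O3). *)
exact: (axO3 ax (axO4 ax (axO2 ax h) h)).
Qed.

Lemma btw_neq23 {a b c} : btw a b c -> b <> c.
Proof. by move=> /(axO2 ax)/btw_neq12 h /esym. Qed.

Lemma btw_excl {a b c} : btw a b c -> ~ btw b c a.
Proof. by move=> h1 h2; exact: (axO3 ax (axO4 ax h1 h2)). Qed.

Lemma btw_path {R a b c} :
  P R -> R a -> R c -> btw a b c -> R b.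
Proof.
move=> PR Ra Rc h; have [S [PS Sa Sb Sc]] := axO1 ax h.
by rewrite (axI3 ax (axO3 ax h) PR PS Ra Rc Sa Sc).
Qed.

Lemma btw_path_outer {R a b c} :
  P R -> R a -> R b -> btw a b c -> R c.
Proof.
move=> PR Ra Rb h; have [S [PS Sa Sb Sc]] := axO1 ax h.
by rewrite (axI3 ax (btw_neq12 h) PR PS Ra Rb Sa Sb).
Qed.

Lemma paths_meet_once R S a b :
  P R -> P S -> R <> S -> R a -> S a -> R b -> S b -> a = b.
Proof.
move=> PR PS nRS Ra Sa Rb Sb; apply: contrapT => nab.
by apply: nRS; exact: (axI3 ax nab).
Qed.

(** * Unreachable sets and the existence of events and paths *)

Lemma not_reach_unreach Q b x : Q x -> ~ unreach P Q b x -> joined P b x.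
Proof. by move=> Qx nu; apply: contrapT => nj; apply: nu. Qed.

Lemma unreach_bounded {Q b x y} : P Q -> ~ Q b ->
  Q x -> joined P b x -> unreach P Q b y ->
  exists z, [/\ Q z, joined P b z & btw x y z].
Proof.
move=> PQ nQb Qx bx uy.
have hx : (Q `\` unreach P Q b)%classic x by split => // -[].
have [q [n [m [[_ _ qn] /andP[m0 mn] q0 qm [Qq nu]]]]] := axI7 ax PQ nQb hx uy.
exists (q n); split => //; first exact: not_reach_unreach nu.
by rewrite -q0 -qm; apply: qn => //; exact: leq_ltn_trans mn.
Qed.

(** By (I5) some event of [R] is unreachable from [b]; (I7) supplies a joined event on its far side
    from [x]. *)
Lemma second_joined_event {R b x} : P R -> ~ R b -> R x -> joined P b x ->
  exists z, [/\ R z, joined P b z & z <> x].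
Proof.
move=> PR nRb Rx bx; have [y [_ [_ uy _]]] := axI5 ax PR nRb.
have [z [Rz bz xyz]] := unreach_bounded PR nRb Rx bx uy.
by exists z; split => // /esym; exact: (axO3 ax xyz).
Qed.

Lemma exists_path_neq Q : exists R, P R /\ R <> Q.
Proof.
have [x [F [FS F4 _ _]]] := axI4 ax (axI1 ax).
apply: contrapT => h.
have FQ R : F R -> R = Q.
  by move=> /FS[PR _]; apply: contrapT => nRQ; apply: h; exists R.
have : (F #<= `I_1)%card.
  (* If [Q] were the only path, the four paths of a 3-SPRAY would all coincide. *)
  by rewrite -(card_le_eqr (card_set1 (x := Q))); apply: subset_card_le => R /FQ.
by rewrite (card_le_eql F4) card_le_II.
Qed.

(** Suppose [Q] contains every event, and take another path [R]. If [R] misses an event, (I5) gives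
    two events on [R], hence on both paths, against (I3); otherwise [R] and [Q] are both the whole
    set. *)
Lemma exists_event_off {Q} : P Q -> exists c, ~ Q c.
Proof.
move=> PQ; have [R [PR nRQ]] := exists_path_neq Q.
apply: contrapT => h.
have Qall c : Q c by apply: contrapT => nQc; apply: h; exists c.
have [[b nRb]|Rall] := pselect (exists b, ~ R b).
  have [x [y [nxy [Rx _] [Ry _]]]] := axI5 ax PR nRb.
  by apply: nRQ; apply: (axI3 ax nxy).
apply: nRQ; apply/seteqP; split => // c _.
by apply: contrapT => nRc; apply: Rall; exists c.
Qed.

Lemma exists_crossing_path {Q o} : P Q -> Q o ->
  exists R, [/\ P R, R o & R <> Q].
Proof.
move=> PQ Qo; have [c nQc] := exists_event_off PQ.
have noc : o <> c by move=> eoc; apply: nQc; rewrite -eoc.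
have [R [S [PR PS Ro Sc [p [Rp Sp]]]]] := axI2 ax noc.
have [eRQ|nRQ] := pselect (R = Q); last by exists R.
rewrite eRQ in Rp.
have nSQ : S <> Q by move=> eSQ; apply: nQc; rewrite -eSQ.
have [So|nSo] := pselect (S o); first by exists S.
(* Here [S] meets [Q] only in [p], so a path from [o] to an event of [S] other than [p] differs from
   [Q]. *)
have [z [Sz [T [PT To Tz]] nzp]] := second_joined_event PS nSo Sp
  (ex_intro _ Q (And3 PQ Qo Rp)).
exists T; split => // eTQ; apply: nzp.
by rewrite eTQ in Tz; exact: (paths_meet_once S Q).
Qed.

Lemma exists_apex {Q b o} : P Q -> Q b -> Q o -> b <> o ->
  exists e, [/\ ~ Q e, joined P b e & joined P o e].
Proof.
move=> PQ Qb Qo nbo.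
have [R [PR Ro nRQ]] := exists_crossing_path PQ Qo.
have nRb : ~ R b.
  by move=> Rb; apply: nbo; exact: (paths_meet_once R Q).
have [e [Re be neo]] := second_joined_event PR nRb Ro
  (ex_intro _ Q (And3 PQ Qb Qo)).
exists e; split => //; last by exists R.
by move=> Qe; apply: neo; exact: (paths_meet_once R Q).
Qed.

(** On a second path through [o] there is an event [g] not joined to [e]. Seen from [g], [o] is
    reachable on [R] and [e] is not, so (I7) gives an event beyond [e]. *)
Lemma prolongation {R o e} : P R -> R o -> R e -> o <> e ->
  exists w, btw o e w.
Proof.
move=> PR Ro Re noe.
have [S [PS So nSR]] := exists_crossing_path PR Ro.
have nSe : ~ S e.
  by move=> Se; apply: noe; exact: (paths_meet_once S R).
have [g [_ [_ [Sg neg] _]]] := axI5 ax PS nSe.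
have nRg : ~ R g by move=> Rg; apply: neg; exists R.
have go : joined P g o by exists S.
have uge : unreach P R g e.
  by split => // -[T [PT Tg Te]]; apply: neg; exists T.
by have [w [_ _ oew]] := unreach_bounded PR nRg Ro go uge; exists w.
Qed.

(** * Triangles and transversals *)

Lemma collinearity Q R S T a b c d e :
  P Q -> P R -> P S -> P T -> Q <> R -> R <> S -> Q <> S ->
  Q a -> R a -> Q b -> S b -> R c -> S c ->
  btw b c d -> btw c e a -> T d -> T e ->
  exists f, [/\ T f, Q f & btw a f b].
Proof.
move=> PQ PR PS PT nQR nRS nQS Qa Ra Qb Sb Rc Sc bcd cea Td Te.
have Sd : S d := btw_path_outer PS Sb Sc bcd.
have Re : R e := btw_path PR Rc Ra cea.
have [f [q [n [[Tf Qf] [n1 _ qn] [q0 qb] [i lein fi] [naf nfb _]]]]] :=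
  axO6 ax PQ PR PS PT nQR nRS nQS (conj Qa Ra)
    (conj Qb Sb) (conj Rc Sc) Sd bcd Re cea Td Te.
(* As [f] differs from both ends, its index is interior; hence the chain has at least three events
   and gives the betweenness. *)
exists f; split => //.
have i0 : 0 < i.
  by rewrite lt0n; apply/eqP => i0; apply: naf; rewrite -q0 -fi i0.
have ltin : i < n.
  rewrite ltn_neqAle lein andbT; apply/eqP => ein.
  by apply: nfb; rewrite -fi ein.
by rewrite -q0 -qb -fi; apply: qn => //; exact: leq_ltn_trans ltin.
Qed.

(** (O6) in the triangle [q], [A], [p] makes [BC] cross the side [q A]. But [BC] meets [AC] only in
    [C], which lies outside that side. *)
Lemma no_transversal_btw AB AC BC T A B C p q r :
  P AB -> P AC -> P BC -> P T ->
  AB <> AC -> AC <> BC -> T <> AB -> T <> AC ->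
  AB A -> AB B -> AC A -> AC C -> BC B -> BC C -> T p -> T q ->
  btw A p B -> btw A q C -> BC r -> ~ btw p r q.
Proof.
move=> PAB PAC PBC PT n1 n2 n3 n4 ABA ABB ACA ACC BCB BCC Tp Tq ApB AqC BCr prq.
have ABp := btw_path PAB ABA ABB ApB.
have ACq := btw_path PAC ACA ACC AqC.
have [f [BCf ACf qfA]] := collinearity AC T AB BC q A p B r PAC PT PAB PBC
  (fun h => n4 (esym h)) n3 (fun h => n1 (esym h)) ACq Tq ACA ABA Tp ABp ApB prq
  BCB BCr.
have efC : f = C by exact: (paths_meet_once AC BC).
by rewrite efC in qfA; exact: btw_excl AqC qfA.
Qed.

(** The crossing events are distinct and lie on [T], so by (O5) one is between the other two; the
    three cases differ by a permutation of the vertices. *)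
Lemma no_transversal AB AC BC T A B C p q r :
  P AB -> P AC -> P BC -> P T ->
  AB <> AC -> AC <> BC -> AB <> BC -> T <> AB -> T <> AC -> T <> BC ->
  AB A -> AB B -> AC A -> AC C -> BC B -> BC C -> T p -> T q -> T r ->
  btw A p B -> btw A q C -> ~ btw B r C.
Proof.
move=> PAB PAC PBC PT n1 n2 n3 n4 n5 n6 ABA ABB ACA ACC BCB BCC Tp Tq Tr
  ApB AqC BrC.
have ABp := btw_path PAB ABA ABB ApB.
have ACq := btw_path PAC ACA ACC AqC.
have BCr := btw_path PBC BCB BCC BrC.
have npq : p <> q.
  move=> epq; rewrite -epq in ACq; apply: (btw_neq12 ApB).
  exact: (paths_meet_once AB AC).
have nqr : q <> r.
  move=> eqr; rewrite -eqr in BCr; apply: (btw_neq23 AqC).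
  exact: (paths_meet_once AC BC).
have npr : p <> r.
  move=> epr; rewrite -epr in BCr; apply: (btw_neq23 ApB).
  exact: (paths_meet_once AB BC).
have [pqr|qrp|rpq] := axO5 ax PT Tp Tq Tr npq nqr npr.
- by apply: (no_transversal_btw AB BC AC T B A C p r q) => //;
    [exact: nesym|exact: (axO2 ax)].
- by apply: (no_transversal_btw AB AC BC T A B C p q r) => //; exact: (axO2 ax).
- apply: (no_transversal_btw AC BC AB T C A B q r p) => //; try exact: (axO2 ax).
  exact: nesym.
Qed.

(** * Excluding the configuration [a o b], [b o c], [a b c] *)

Lemma move_outward {Q w o a} : P Q -> ~ Q w -> Q o -> Q a -> joined P w o ->
  exists a', [/\ Q a', joined P w a' & a' = a \/ btw o a a'].
Proof.
move=> PQ nQw Qo Qa wo.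
have [wa|nwa] := pselect (joined P w a); first by exists a; split => //; left.
have [a' [Qa' wa' oaa']] := unreach_bounded PQ nQw Qo wo (conj Qa nwa).
by exists a'; split => //; right.
Qed.

Lemma outward_btw {o a b c a'} : btw a o b -> btw a b c ->
  a' = a \/ btw o a a' -> btw a' o b /\ btw a' b c.
Proof.
move=> aob abc [->//|/(axO2 ax) a'ao].
have aa'b := axO4 ax a'ao aob.
have boa' := axO4 ax (axO2 ax aob) (axO2 ax a'ao).
split; first exact: (axO2 ax).
apply: (axO2 ax); exact: (axO4 ax (axO2 ax abc) (axO2 ax aa'b)).
Qed.

Lemma no_star {a b c o} : btw a o b -> btw b o c -> ~ btw a b c.
Proof.
move=> aob boc abc.
have [Q [PQ Qa Qb Qc]] := axO1 ax abc.
have Qo := btw_path PQ Qa Qb aob.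
have nbo : b <> o by apply: nesym; exact: (btw_neq23 aob).
have [e [nQe [T [PT Tb Te]] [R [PR Ro Re]]]] := exists_apex PQ Qb Qo nbo.
have noe : o <> e by move=> eoe; apply: nQe; rewrite -eoe.
have [w oew] := prolongation PR Ro Re noe.
have Rw := btw_path_outer PR Ro Re oew.
have nRQ : R <> Q by move=> eRQ; apply: nQe; rewrite -eRQ.
have nQw : ~ Q w.
  by move=> Qw; apply: (axO3 ax oew); exact: (paths_meet_once R Q).
have wo : joined P w o by exists R.
have [a' [Qa' [A [PA Aw Aa']] ha']] := move_outward PQ nQw Qo Qa wo.
have [c' [Qc' [C [PC Cw Cc']] hc']] := move_outward PQ nQw Qo Qc wo.
have [a'ob a'bc] := outward_btw aob abc ha'.
have [c'ob c'ba'] := outward_btw (axO2 ax boc)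
  (axO2 ax a'bc) hc'.
have off X x y : P X -> X w -> X x -> Q x -> Q y -> x <> y -> ~ X y.
  move=> PX Xw Xx Qx Qy nxy Xy; apply: nQw.
  by have -> := axI3 ax nxy PQ PX Qx Qy Xx Xy.
have neqQ (X : set E) : X w -> X <> Q by move=> Xw eXQ; apply: nQw; rewrite -eXQ.
(* These non-incidences keep the paths of the triangles and the transversal [T] distinct. *)
have nAo := off _ _ _ PA Aw Aa' Qa' Qo (btw_neq12 a'ob).
have nCo := off _ _ _ PC Cw Cc' Qc' Qo (btw_neq12 c'ob).
have nAb := off _ _ _ PA Aw Aa' Qa' Qb (axO3 ax a'ob).
have nCb := off _ _ _ PC Cw Cc' Qc' Qb (axO3 ax c'ob).
have nCa' := off _ _ _ PC Cw Cc' Qc' Qa' (axO3 ax c'ba').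
(* In the triangle [w], [a'], [o] the path [T] meets the side [o w] in [e] and the prolonged side
   [a' o] in [b]. *)
have [f [Tf Af wfa']] : exists f, [/\ T f, A f & btw w f a'].
  apply: (collinearity A R Q T w a' o b e) => //; last exact: neqQ.
  by move=> eAR; apply: nAo; rewrite eAR.
have [g [Tg Cg wgc']] : exists g, [/\ T g, C g & btw w g c'].
  apply: (collinearity C R Q T w c' o b e) => //; last exact: neqQ.
  by move=> eCR; apply: nCo; rewrite eCR.
apply: (no_transversal A C Q T w a' c' f g b) => //; last exact: (axO2 ax).
- by move=> eAC; apply: nCa'; rewrite -eAC.
- exact: neqQ.
- exact: neqQ.
- by move=> eTA; apply: nAb; rewrite -eTA.
- by move=> eTC; apply: nCb; rewrite -eTC.
- by move=> eTQ; apply: nQe; rewrite -eTQ.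
Qed.

(** * Covering a segment by the links of a chain *)

Lemma btw_split {a m c y} : btw a m c -> btw a y c -> y <> m ->
  btw a y m \/ btw m y c.
Proof.
move=> amc ayc nym.
have [Q [PQ Qa Qm Qc]] := axO1 ax amc.
have Qy := btw_path PQ Qa Qc ayc.
have [aym|yma|may] := axO5 ax PQ Qa Qy Qm (btw_neq12 ayc) nym
  (btw_neq12 amc).
- by left.
- have [ymc|mcy|cym] := axO5 ax PQ Qy Qm Qc nym (btw_neq23 amc)
    (btw_neq23 ayc).
  (* The only case not settled by (O2)-(O4): the excluded configuration with [m] as its centre. *)
  + by case: (no_star (axO2 ax yma) ymc ayc).
  + by case: (btw_excl ayc (axO4 ax (axO2 ax mcy) (axO2 ax amc))).
  + by right; exact: (axO2 ax).
- by case: (btw_excl (axO2 ax ayc) (axO4 ax (axO2 ax may) amc)).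
Qed.

(** Induction on the number of links, splitting at the last but one event. Each link is taken with
    its right end only, which matches the form of (I6). *)
Lemma chain_cover {q n y} :
  (forall i j k, i < j -> j < k -> k <= n.+1 -> btw (q i) (q j) (q k)) ->
  btw (q 0) y (q n.+1) ->
  exists2 i, i <= n & y = q i.+1 \/ btw (q i) y (q i.+1).
Proof.
elim: n => [|n IH] qn h; first by exists 0 => //; right.
have [->|nyq] := pselect (y = q n.+1); first by exists n => //; left.
have [h'|h'] := btw_split (qn 0 n.+1 n.+2 isT (ltnSn _) (leqnn _)) h nyq.
  have [|i lein hi] := IH _ h'; last by exists i => //; exact: leqW.
  by move=> i j k ij jk kn; apply: qn => //; exact: leqW.
by exists n.+1 => //; right.
Qed.

End Spacetime.

Theorem theorem13 (E : Type) (P : set (set E)) (btw : E -> E -> E -> Prop)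
    (ax : spacetime_axioms P btw)
    (Q : set E) (PQ : P Q) (b : E) (nQb : ~ Q b)
    (Qx Qz : E) (hx : unreach P Q b Qx) (hz : unreach P Q b Qz) (hxz : Qx <> Qz)
    (Qy : E) :
  btw Qx Qy Qz -> unreach P Q b Qy.
Proof.
have [q [[|n] [[// _ _ qn] q0 qz hq]]] := axI6 ax PQ nQb hx hz hxz.
rewrite -q0 -qz => h.
(* The guard that the last index is at least 2 follows from the presence of three increasing
   indices. *)
have qbtw i j k : i < j -> j < k -> k <= n.+1 -> btw (q i) (q j) (q k).
  move=> ij jk kn; apply: qn => //; apply: leq_trans kn.
  by case: j ij jk => // j _; exact: leq_ltn_trans.
have [i lein [->|hi]] := chain_cover ax qbtw h.
  by have [] := hq i.+1 lein.
by have [_] := hq i.+1 lein; exact.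
Qed.
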